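(* Let $s\in\mathbb{R}^N$ be the net aggregate incomes of each transmission node in an electricity network with node set $\mathcal N=\{1,\dots,N\}$, and let $z^*:=(g^*,p^*,\mu^*,\nu^* )\in\mathbb{R}^{3K+4M+1}$ be a (primal-dual) solution to the DC optimal power flow (DC OPF) program defined in the context; write $x^*=(g^*,p^* )$. Suppose that $$s_i>0\quad\text{for all } i\in\mathcal N,$$ and that the Jacobian matrix $$\frac{\partial k}{\partial z}(z^*;\theta)=\begin{bmatrix} Q & G^\top & A^\top\\ \operatorname{diag}(\mu^* )G & \operatorname{diag}(Gx^*-h) & 0\\ A & 0 & 0\end{bmatrix}$$ is non-singular, where $Q$, $A$, $G$, $h$ and the KKT operator $k$ are as defined in the context. Then the locational marginal burden matrix $$\frac{\partial b}{\partial d}=-\operatorname{diag}(d\oslash s)\begin{bmatrix}F^\top & \mathbf 1\end{bmatrix}\frac{\partial \nu^*}{\partial d}+\operatorname{diag}\bigl(\pi(\nu^* )\oslash s\bigr)$$ is well-defined in a neighborhood around the OPF solution $z^*$.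
   Context: Notation: $\mathbf 1$ is an all-ones vector, $I_n$ the $n\times n$ identity, $\oslash$ is elementwise division of vectors, $\operatorname{diag}(v)$ is the diagonal matrix with the entries of $v$ on its diagonal, and vector inequalities are entrywise. Network: there are $N$ nodes (buses), $M$ lines and $K$ generators, with at most one generator per node. $F\in\mathbb{R}^{M\times N}$ is the power transfer distribution factor matrix. $B\in\{0,1\}^{N\times K}$ is the generator-to-node incidence matrix, $B_{ij}=1$ if generator $j$ is at node $i$ and $0$ otherwise. $d\in\mathbb{R}^N$ is the vector of demands; $\alpha,\beta\in\mathbb{R}^K$ are the quadratic and linear generator cost coefficients; $\overline g\in\mathbb{R}^K$ and $\overline p\in\mathbb{R}^M$ are generation and line flow limits. The fixed parameters are collected in $\theta=(d,\alpha,\beta)$. DC OPF program: over generation set points $g\in\mathbb{R}^K$ and line flows $p\in\mathbb{R}^M$, $$\min_{g,p}\ \sum_{i=1}^K \alpha_i g_i^2+\beta_i g_i\quad\text{s.t.}\quad F(Bg-d)=p,\quad \mathbf 1^\top Bg=\mathbf 1^\top d,\quad -\overline p\le p\le\overline p,\quad 0\le g\le\overline g.$$ It is written as a general-form quadratic program in $x=(g,p)$, $$\min_x\ \tfrac12x^\top Qx+w^\top x\quad\text{s.t.}\quad Gx\le h,\quad Ax=y,$$ with $$Q=\begin{bmatrix}\operatorname{diag}(\alpha)&0\\ 0&\tau I_M\end{bmatrix},\ w=\begin{bmatrix}\beta\\ 0\end{bmatrix},\ A=\begin{bmatrix}FB&-I_M\\ \mathbf 1^\top B&0\end{bmatrix},\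 G=\begin{bmatrix}-I_K&0\\ I_K&0\\ 0&-I_M\\ 0&I_M\end{bmatrix},\ h=\begin{bmatrix}0\\ \overline g\\ \overline p\\ \overline p\end{bmatrix},\ y=\begin{bmatrix}Fd\\ \mathbf 1^\top d\end{bmatrix},$$ where $\tau>0$ is a small regularization parameter introduced to yield a strongly convex objective. Dual variables and KKT operator: $\mu\in\mathbb{R}^{2K+2M}$ and $\nu\in\mathbb{R}^{M+1}$ are the dual variables of $Gx\le h$ and $Ax=y$, with Lagrangian $\tfrac12x^\top Qx+w^\top x+\mu^\top(Gx-h)+\nu^\top(Ax-y)$. With $z=(x,\mu,\nu)$, the KKT operator is $$k(z;\theta)=\begin{bmatrix}Qx+w+G^\top\mu+A^\top\nu\\ \operatorname{diag}(\mu)(Gx-h)\\ Ax-y\end{bmatrix},$$ and a solution $z^*$ satisfies $k(z^*;\theta)=0$. Prices and energy burden: a single utility serves all customers, and every customer is exposed to the wholesale price of electricity, so the retail prices equal the locational marginal prices, $\pi(\nu^* )=-\begin{bmatrix}F^\top&\mathbf 1\end{bmatrix}\nu^*\in\mathbb{R}^N$. The energy burden function is $b:\mathbb{R}^N\times\mathbb{R}^N\to(0,1]^N$, $b(\pi;d)=\operatorname{diag}(d\oslash s)\,\pi$. The locational marginal burden matrix is the Jacobian of the energy burden with respect to demand, when the prices are those given by the dual optimal variables $\nu^*$ viewed as a function of $d$; its $(i,j)$ entry is the change in energy burden at node $i$ with respect to the demand at node $j$. Here $\partial\nu^*/\partial d$ is the Jacobian with respect to $d$ of the optimal dual variables associated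 with the equality constraints of the DC OPF program. *)

(* Defs.v *)
From HB Require Import structures.
From mathcomp Require Import all_boot all_order all_algebra.
From mathcomp Require Import all_classical all_reals all_analysis.

Set Implicit Arguments.
Unset Strict Implicit.
Unset Printing Implicit Defensive.

Import Order.TTheory GRing.Theory Num.Theory.
Import numFieldNormedType.Exports.

Local Open Scope classical_set_scope.
Local Open Scope ring_scope.

Notation opf_dim_x M K := (K + M)%N (only parsing).
Notation opf_dim_ineq M K := (K + (K + (M + M)))%N (only parsing).
Notation opf_dim_eq M := (M + 1)%N (only parsing).
(* 3 K + 4 M + 1, the size of z = (x, mu, nu) with x = (g, p) *)
Notation opf_dim M K :=
  (opf_dim_x M K + (opf_dim_ineq M K + opf_dim_eq M))%N (only parsing).

Section Vectors.
Variable R : realType.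

Definition le_vec n (u v : 'cV[R]_n) : Prop := forall i, u i 0 <= v i 0.

Definition diagc n (v : 'cV[R]_n) : 'M[R]_n := diag_mx v^T.

Definition oslash n (u v : 'cV[R]_n) : 'cV[R]_n := \col_i (u i 0 / v i 0).

(* Matrix of partial derivatives of a map between spaces of column vectors:
   the (i, j) entry is the derivative of the i-th component of f along the
   j-th coordinate. The library's [jacobian] is about row vectors acting on
   the left, hence is the transpose of this one. The value is meaningful only
   where f is differentiable. *)
Definition jacobianc n m (f : 'cV[R]_n -> 'cV[R]_m) (x : 'cV[R]_n) :
    'M[R]_(m, n) :=
  \matrix_(i, j) ('D_(delta_mx j 0) f x) i 0.

End Vectors.

(* N nodes, M lines, K generators; everything but the demand d, which is kept
   apart because it is the variable of differentiation. *)
Record opf_data (R : realType) (N M K : nat) := OpfData {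
  ptdf : 'M[R]_(M, N) ;
  gen_node : 'I_K -> 'I_N ; (* the node where a generator is located *)
  cost2 : 'cV[R]_K ;        (* alpha *)
  cost1 : 'cV[R]_K ;        (* beta *)
  gmax : 'cV[R]_K ;
  pmax : 'cV[R]_M ;
  tau : R }.

Section OPF.
Variables (R : realType) (N M K : nat) (P : opf_data R N M K).

Local Notation F := (ptdf P).

Definition gen_incidence : 'M[R]_(N, K) :=
  \matrix_(i, j) (gen_node P j == i)%:R.

Definition opf_Q : 'M[R]_(opf_dim_x M K) :=
  block_mx (diagc (cost2 P)) 0 0 (tau P)%:M.

Definition opf_w : 'cV[R]_(opf_dim_x M K) := col_mx (cost1 P) 0.

Definition opf_A : 'M[R]_(opf_dim_eq M, opf_dim_x M K) :=
  block_mx (F *m gen_incidence) (- 1%:M)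
           ((const_mx 1 : 'rV[R]_N) *m gen_incidence) 0.

Definition opf_G : 'M[R]_(opf_dim_ineq M K, opf_dim_x M K) :=
  col_mx (row_mx (- 1%:M) 0)
 (col_mx (row_mx 1%:M 0)
 (col_mx (row_mx 0 (- 1%:M))
         (row_mx 0 1%:M))).

Definition opf_h : 'cV[R]_(opf_dim_ineq M K) :=
  col_mx 0 (col_mx (gmax P) (col_mx (pmax P) (pmax P))).

Definition opf_y (d : 'cV[R]_N) : 'cV[R]_(opf_dim_eq M) :=
  col_mx (F *m d) ((const_mx 1 : 'rV[R]_N) *m d).

Definition opf_obj (x : 'cV[R]_(opf_dim_x M K)) : R :=
  2^-1 * (x^T *m opf_Q *m x) 0 0 + (opf_w^T *m x) 0 0.

Definition opf_feasible (d : 'cV[R]_N) (x : 'cV[R]_(opf_dim_x M K)) : Prop :=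
  le_vec (opf_G *m x) opf_h /\ opf_A *m x = opf_y d.

Definition primal_optimal (d : 'cV[R]_N) (x : 'cV[R]_(opf_dim_x M K)) : Prop :=
  opf_feasible d x /\
  forall x', opf_feasible d x' -> opf_obj x <= opf_obj x'.

Definition lagrangian (d : 'cV[R]_N) (x : 'cV[R]_(opf_dim_x M K))
    (mu : 'cV[R]_(opf_dim_ineq M K)) (nu : 'cV[R]_(opf_dim_eq M)) : R :=
  opf_obj x + (mu^T *m (opf_G *m x - opf_h)) 0 0
            + (nu^T *m (opf_A *m x - opf_y d)) 0 0.

Definition dual_fun (d : 'cV[R]_N)
    (mu : 'cV[R]_(opf_dim_ineq M K)) (nu : 'cV[R]_(opf_dim_eq M)) : \bar R :=
  ereal_inf [set (lagrangian d x mu nu)%:E | x in setT].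

Definition dual_optimal (d : 'cV[R]_N)
    (mu : 'cV[R]_(opf_dim_ineq M K)) (nu : 'cV[R]_(opf_dim_eq M)) : Prop :=
  le_vec 0 mu /\
  forall mu' nu', le_vec 0 mu' -> (dual_fun d mu' nu' <= dual_fun d mu nu)%E.

Definition x_part (z : 'cV[R]_(opf_dim M K)) : 'cV[R]_(opf_dim_x M K) :=
  usubmx z.
Definition mu_part (z : 'cV[R]_(opf_dim M K)) : 'cV[R]_(opf_dim_ineq M K) :=
  usubmx (dsubmx z).
Definition nu_part (z : 'cV[R]_(opf_dim M K)) : 'cV[R]_(opf_dim_eq M) :=
  dsubmx (dsubmx z).

(* The last clause (no duality gap) is automatic when alpha >= 0, the program
   being then a convex quadratic program. It holds for no pair when some
   entry of alpha is negative, since the dual function is then -oo; so no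
   sign condition on alpha is needed elsewhere. *)
Definition primal_dual_solution (d : 'cV[R]_N) (z : 'cV[R]_(opf_dim M K)) :
    Prop :=
  [/\ primal_optimal d (x_part z),
      dual_optimal d (mu_part z) (nu_part z) &
      dual_fun d (mu_part z) (nu_part z) = (opf_obj (x_part z))%:E].

Definition kkt (z : 'cV[R]_(opf_dim M K)) (d : 'cV[R]_N) :
    'cV[R]_(opf_dim M K) :=
  col_mx (opf_Q *m x_part z + opf_w
            + opf_G^T *m mu_part z + opf_A^T *m nu_part z)
 (col_mx (diagc (mu_part z) *m (opf_G *m x_part z - opf_h))
         (opf_A *m x_part z - opf_y d)).

Definition kkt_block (z : 'cV[R]_(opf_dim M K)) : 'M[R]_(opf_dim M K) :=
  col_mx (row_mx opf_Q (row_mx opf_G^T opf_A^T))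
 (col_mx (row_mx (diagc (mu_part z) *m opf_G)
                 (row_mx (diagc (opf_G *m x_part z - opf_h)) 0))
         (row_mx opf_A (row_mx 0 0))).

Definition price (nu : 'cV[R]_(opf_dim_eq M)) : 'cV[R]_N :=
  - (row_mx F^T (const_mx 1) *m nu).

End OPF.

Definition burden (R : realType) (N : nat) (s pi d : 'cV[R]_N) : 'cV[R]_N :=
  diagc (oslash d s) *m pi.

(* The energy burden as a function of demand, when the prices are those given
   by the dual variables nu, themselves a function of demand. *)
Definition burden_of_demand (R : realType) (N M K : nat)
    (P : opf_data R N M K) (s : 'cV[R]_N)
    (nu : 'cV[R]_N -> 'cV[R]_(opf_dim_eq M)) (d : 'cV[R]_N) : 'cV[R]_N :=
  burden s (price P (nu d)) d.

Definition lmb_matrix (R : realType) (N M K : nat)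
    (P : opf_data R N M K) (s : 'cV[R]_N)
    (nu : 'cV[R]_N -> 'cV[R]_(opf_dim_eq M)) (d : 'cV[R]_N) : 'M[R]_N :=
  jacobianc (burden_of_demand P s nu) d.

(* Main.v *)
Require Import Defs.
From HB Require Import structures.
From mathcomp Require Import all_boot all_order all_algebra.
From mathcomp Require Import all_classical all_reals all_analysis.
From mathcomp Require Import ring lra.

(* Nonsingularity of the KKT Jacobian forces strict complementarity: if mu_i and
   the i-th slack both vanished, so would a row. Near z the factor of each
   complementarity product that is nonzero at z keeps its sign, so the other
   factor has to vanish and the KKT system is equivalent to the linear system
   J (z' - z) = (0, 0, y(d') - y(d)). The local solution map is therefore affine
   in d', and no implicit function theorem is needed. The sign conditions give
   mu' >= 0 and G x' <= h; since the dual function is finite at z, Q is positive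
   semidefinite, hence these KKT points are primal-dual optimal. *)

Set Implicit Arguments.
Unset Strict Implicit.
Unset Printing Implicit Defensive.

Import Order.TTheory GRing.Theory Num.Theory.
Import numFieldNormedType.Exports.

Local Open Scope classical_set_scope.
Local Open Scope ring_scope.

(** * Topology and differential calculus for maps between spaces of column vectors *)

Lemma open_forall_gt0 (R : realType) (T : topologicalType) (I : finType)
    (phi : I -> T -> R) :
  (forall i, continuous (phi i)) -> open [set x | forall i, 0 < phi i x].
Proof.
move=> phi_cont; rewrite openE => x /= phi_x.
apply: filter_forall => i.
exact: (cvgr_gt (phi i x) (phi_cont i x) 0 (phi_x i)).
Qed.

Section Differentiability.
Variable R : realType.

Lemma differentiable_colP (V : normedModType R) n (f : V -> 'cV[R]_n) x :
  (forall i, differentiable (fun u => f u i 0) x) -> differentiable f x.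
Proof.
move=> df; have -> : f = \sum_i (fun u => f u i 0 *: delta_mx i 0).
  apply/funext => u; rewrite fct_sumE [LHS]matrix_sum_delta.
  by apply: eq_bigr => i _; rewrite big_ord1.
by apply: differentiable_sum => i; exact: differentiableZl.
Qed.

Lemma mulmx_continuous m n (C : 'M[R]_(m, n)) :
  continuous (mulmx C : 'cV[R]_n -> 'cV[R]_m).
Proof.
move=> x; apply: differentiable_continuous; apply: differentiable_colP => i.
have -> : (fun u : 'cV[R]_n => (C *m u) i 0) =
    \sum_j (C i j *: (fun u : 'cV[R]_n => u j 0)).
  by apply/funext => u; rewrite fct_sumE mxE.
apply: differentiable_sum => j; apply: differentiableZ.
exact: differentiable_coord.
Qed.

Lemma is_diff_mulmx_coord m n (C : 'M[R]_(m, n)) (x : 'cV[R]_n) i :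
  is_diff x (fun u => (C *m u) i 0) (fun u => (C *m u) i 0).
Proof.
pose f := fun u : 'cV[R]_n => (C *m u) i 0.
have f_lin : linear (f : 'cV[R]_n -> R^o).
  by move=> a u v; rewrite /f linearP !mxE.
pose fL : {linear 'cV[R]_n -> R^o} :=
  HB.pack (f : 'cV[R]_n -> R^o) (GRing.isLinear.Build _ _ _ _ _ f_lin).
have f_cont : continuous fL.
  move=> u; apply: (@continuous_comp _ _ _ (mulmx C) (fun v => v i 0)).
    exact: mulmx_continuous.
  exact: coord_continuous.
apply: DiffDef; first exact: (@linear_differentiable _ _ _ fL).
exact: (@diff_lin _ _ _ fL).
Qed.

(** Reduces a Jacobian computation to scalar components, where the product and chain rules apply:
    the differential of a component at [delta_mx j 0] reads off an entry of column [j] of [L]. *)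
Lemma is_diff_jacobianc n m (f : 'cV[R]_n -> 'cV[R]_m) x (L : 'M[R]_(m, n)) :
  (forall i, is_diff x (fun u => f u i 0) (fun v => (L *m v) i 0)) ->
  differentiable f x /\ jacobianc f x = L.
Proof.
move=> df; have f_diff : differentiable f x.
  by apply: differentiable_colP => i; exact: ex_diff.
split => //; apply/matrixP => i j; rewrite mxE derive_mx ?mxE; last first.
  exact: diff_derivable.
rewrite deriveE; last exact: ex_diff.
by rewrite diff_val -colE mxE.
Qed.

Lemma diff_jacobianc n m (f : 'cV[R]_n -> 'cV[R]_m) x :
  differentiable f x ->
  'd f x = mulmx (jacobianc f x) :> ('cV[R]_n -> 'cV[R]_m).
Proof.
move=> df; apply/funext => v; apply/matrixP => i k; rewrite ord1.
rewrite [in LHS](matrix_sum_delta v) linear_sum summxE mxE.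
apply: eq_bigr => j _; rewrite big_ord1 linearZ mxE mulrC.
by rewrite [in RHS]mxE deriveE.
Qed.

Lemma is_diff_affine_coord m n (C : 'M[R]_(m, n)) (c : R) (x : 'cV[R]_n) i :
  is_diff x (fun u => (C *m u) i 0 + c) (fun u => (C *m u) i 0).
Proof.
have dC := is_diff_mulmx_coord C x i; have dc := is_diff_cst c x.
apply: is_diff_eq (is_diffD dC dc) _.
by apply/funext => u; rewrite /= addr0.
Qed.

Lemma affine_coord_continuous m n (C : 'M[R]_(m, n)) (c : R) i :
  continuous (fun u : 'cV[R]_n => (C *m u) i 0 + c).
Proof.
move=> u; apply: differentiable_continuous.
exact: (@ex_diff _ _ _ _ _ _ _ (is_diff_affine_coord C c u i)).
Qed.

Lemma affine_jacobianc m n (C : 'M[R]_(m, n)) (c : 'cV[R]_m) (x : 'cV[R]_n) :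
  differentiable (fun u => C *m u + c) x /\
  jacobianc (fun u => C *m u + c) x = C.
Proof.
apply: is_diff_jacobianc => i.
have -> : (fun u => (C *m u + c) i 0) = (fun u => (C *m u) i 0 + c i 0).
  by apply/funext => u; rewrite mxE.
exact: is_diff_affine_coord.
Qed.

End Differentiability.

(** * Lagrangian duality for the quadratic program *)

Section Duality.
Variables (R : realType) (N M K : nat) (P : opf_data R N M K).
Implicit Types (d : 'cV[R]_N) (x v : 'cV[R]_(opf_dim_x M K)).
Implicit Types (mu : 'cV[R]_(opf_dim_ineq M K)) (nu : 'cV[R]_(opf_dim_eq M)).
Implicit Types z : 'cV[R]_(opf_dim M K).

(** The gradient of the Lagrangian in [x]. *)
Definition stationarity x mu nu : 'cV[R]_(opf_dim_x M K) :=
  opf_Q P *m x + opf_w P + (opf_G R M K)^T *m mu + (opf_A P)^T *m nu.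

(** Sign convention: nonpositive at feasible points. *)
Definition slack x : 'cV[R]_(opf_dim_ineq M K) := opf_G R M K *m x - opf_h P.

Lemma slack_le0P x :
  le_vec (opf_G R M K *m x) (opf_h P) <-> forall i, slack x i 0 <= 0.
Proof.
have slackE i : slack x i 0 = (opf_G R M K *m x) i 0 - opf_h P i 0.
  by rewrite /slack mxE [(- opf_h P) i 0]mxE.
by split=> h i; have := h i; rewrite slackE subr_le0.
Qed.

(** [cost2] carries no sign condition; convexity is extracted from the finite dual value at a
    primal-dual pair. *)
Definition Q_psd : Prop := forall v, 0 <= (v^T *m opf_Q P *m v) 0 0.

Lemma trmx_opf_Q : (opf_Q P)^T = opf_Q P.
Proof. by rewrite /opf_Q tr_block_mx !trmx0 /diagc tr_diag_mx tr_scalar_mx. Qed.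

Lemma mxD00 m n (X Y : 'M[R]_(m.+1, n.+1)) : (X + Y) 0 0 = X 0 0 + Y 0 0.
Proof. by rewrite mxE. Qed.

Lemma dotC n (u v : 'cV[R]_n) : (u^T *m v) 0 0 = (v^T *m u) 0 0.
Proof. by rewrite -[in RHS](trmxK u) -trmx_mul [RHS]mxE. Qed.

Lemma dotE n (u v : 'cV[R]_n) : (u^T *m v) 0 0 = \sum_i u i 0 * v i 0.
Proof. by rewrite mxE; apply: eq_bigr => i _; rewrite mxE. Qed.

Lemma opf_objD x v :
  opf_obj P (x + v) = opf_obj P x + ((opf_Q P *m x + opf_w P)^T *m v) 0 0
                      + 2^-1 * (v^T *m opf_Q P *m v) 0 0.
Proof.
have Qvx : (v^T *m opf_Q P *m x) 0 0 = (x^T *m opf_Q P *m v) 0 0.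
  by rewrite -mulmxA dotC trmx_mul trmx_opf_Q.
rewrite /opf_obj !(linearD, mulmxDl, mulmxDr) /= trmx_mul trmx_opf_Q.
rewrite !mulmxDl !mxD00 Qvx.
by field.
Qed.

(** The second-order Taylor expansion is exact because the Lagrangian is quadratic in [x]. Both
    directions between optimality and the KKT conditions rest on it. *)
Lemma lagrangianD d x v mu nu :
  lagrangian P d (x + v) mu nu =
  lagrangian P d x mu nu + ((stationarity x mu nu)^T *m v) 0 0
  + 2^-1 * (v^T *m opf_Q P *m v) 0 0.
Proof.
rewrite /lagrangian opf_objD /stationarity.
set q := opf_Q P *m x + opf_w P.
rewrite !(linearD, mulmxDl, mulmxDr) /= !trmx_mul !trmxK -!mulmxA.
by rewrite !mxD00; ring.
Qed.

Lemma dual_fun_le d x mu nu :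
  (dual_fun P d mu nu <= (lagrangian P d x mu nu)%:E)%E.
Proof.
by apply: ge_ereal_inf; exists (lagrangian P d x mu nu)%:E => //; exists x.
Qed.

Lemma lagrangian_feasible d x mu nu : opf_A P *m x = opf_y P d ->
  lagrangian P d x mu nu = opf_obj P x + \sum_i mu i 0 * slack x i 0.
Proof.
rewrite /lagrangian => ->.
by rewrite subrr mulmx0 [X in _ + X]mxE addr0 dotE.
Qed.

Lemma weak_duality d x mu nu : opf_feasible P d x -> le_vec 0 mu ->
  (dual_fun P d mu nu <= (opf_obj P x)%:E)%E.
Proof.
move=> [Gx Ax] mu_ge0; apply: le_trans (dual_fun_le d x mu nu) _.
rewrite lee_fin lagrangian_feasible // gerDl sumr_le0 // => i _.
have := mu_ge0 i; rewrite mxE => mui.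
by rewrite mulr_ge0_le0 //; move/slack_le0P: Gx; apply.
Qed.

(** Adding the values at [1] and [-1] gives the sign of [a]; a nonzero [b] would make the polynomial
    negative close to [0]. *)
Lemma quadratic_ge0 (a b : R) :
  (forall t, 0 <= b * t + a * t ^+ 2) -> b = 0 /\ 0 <= a.
Proof.
move=> ab_ge0; have a_ge0 : 0 <= a.
  by have := ab_ge0 1; have := ab_ge0 (-1); rewrite !expr2; lra.
split=> //.
(* Here [b = - 2 (a + 1) t], so the value is [- (a + 2) t ^ 2], which forces [t = 0]. Using [a + 1]
   keeps the denominator positive when [a = 0]. *)
have := ab_ge0 (- b / (2 * (a + 1))).
set t := _ / _; have tE : t * (2 * (a + 1)) = - b by rewrite divfK //; lra.
have bE : b = - t * (2 * (a + 1)) by lra.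
rewrite bE => /[dup] tt.
have t0 : t ^+ 2 <= 0 by nra.
have /eqP : t ^+ 2 == 0 by rewrite eq_le t0 sqr_ge0.
by move/eqP; rewrite sqrf_eq0 => /eqP ->; rewrite oppr0 mul0r.
Qed.

Definition kkt_conditions d z : Prop :=
  [/\ stationarity (x_part z) (mu_part z) (nu_part z) = 0,
      opf_feasible P d (x_part z),
      le_vec 0 (mu_part z) &
      forall i, mu_part z i 0 * slack (x_part z) i 0 = 0].

(** Without a duality gap, the objective at [x] bounds the Lagrangian from below everywhere. At [x]
    itself this gives complementarity; along lines through [x] it gives a zero gradient and a
    nonnegative curvature. *)
Lemma primal_dual_solution_kkt d z :
  primal_dual_solution P d z -> Q_psd /\ kkt_conditions d z.
Proof.
case=> -[x_feas _] [mu_ge0 _].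
set x := x_part z; set mu := mu_part z; set nu := nu_part z => strong.
have [Gx Ax] := x_feas.
have /slack_le0P slack_le0 := Gx.
have mu_slack_le0 i : mu i 0 * slack x i 0 <= 0.
  by rewrite mulr_ge0_le0 //; have := mu_ge0 i; rewrite mxE.
have obj_le x' : opf_obj P x <= lagrangian P d x' mu nu.
  by rewrite -lee_fin -strong dual_fun_le.
(* The terms are nonpositive, while the lower bound at [x] makes their sum nonnegative; each term
   then vanishes as well. *)
have sum0 : \sum_i mu i 0 * slack x i 0 = 0.
  apply/eqP; rewrite eq_le sumr_le0 //=.
  by have := obj_le x; rewrite lagrangian_feasible // lerDl.
have line v t : 0 <= ((stationarity x mu nu)^T *m v) 0 0 * t
                     + 2^-1 * (v^T *m opf_Q P *m v) 0 0 * t ^+ 2.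
  have := obj_le (x + t *: v).
  rewrite lagrangianD lagrangian_feasible // sum0 addr0 -addrA lerDl.
  have -> : (t *: v)^T = t *: v^T by rewrite linearZ.
  rewrite -!scalemxAr -!scalemxAl scalerA.
  rewrite [X in X + _]mxE [X in _ + _ * X]mxE => /le_trans; apply.
  by rewrite le_eqVlt; apply/orP; left; apply/eqP; ring.
split=> [v|].
  by have [_] := quadratic_ge0 (line v); rewrite pmulr_rge0 // invr_gt0.
split=> // [|i].
  apply/eqP; rewrite -/x -/mu -/nu; set g := stationarity _ _ _.
  (* Moving along the gradient itself turns the vanishing linear coefficient into a sum of
     squares. *)
  have [+ _] := quadratic_ge0 (line g); rewrite dotE => /eqP.
  rewrite psumr_eq0 => [/allP g0|i _]; last by rewrite -expr2 sqr_ge0.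
  apply/eqP/matrixP => i j; rewrite ord1 [RHS]mxE.
  by have := g0 i (mem_index_enum _); rewrite /= mulf_eq0 orbb => /eqP.
have /eqP := sum0; rewrite -oppr_eq0 -sumrN psumr_eq0 => [/allP c0|k _].
  by have := c0 i (mem_index_enum _); rewrite /= oppr_eq0 => /eqP.
by rewrite oppr_ge0.
Qed.

(** With a zero gradient and convexity, the Taylor expansion makes [x_part z] a global minimizer of
    the Lagrangian, so the dual value equals the objective. Weak duality then yields both optimality
    claims. *)
Lemma kkt_primal_dual_solution d z :
  Q_psd -> kkt_conditions d z -> primal_dual_solution P d z.
Proof.
move=> Q_ge0 [grad0 x_feas mu_ge0 compl].
have dualE : dual_fun P d (mu_part z) (nu_part z) = (opf_obj P (x_part z))%:E.
  apply/eqP; rewrite eq_le weak_duality //=.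
  apply: le_ereal_inf_tmp => _ [x _ <-]; rewrite lee_fin.
  rewrite -(subrKC (x_part z) x) lagrangianD grad0 trmx0 mul0mx.
  rewrite lagrangian_feasible; last by case: x_feas.
  rewrite big1 // addr0 [X in _ + X + _]mxE addr0 lerDl mulr_ge0 ?invr_ge0 //.
split=> //.
  by split=> // x' x'_feas; rewrite -lee_fin -dualE weak_duality.
by split=> // mu' nu' mu'_ge0; rewrite dualE weak_duality.
Qed.

End Duality.

(** * The KKT operator: exact linearization, strict complementarity and Jacobian *)

Section KKTJacobian.
Variables (R : realType) (N M K : nat) (P : opf_data R N M K).
Implicit Types (d : 'cV[R]_N) (z dz : 'cV[R]_(opf_dim M K)).

Lemma kktE z d :
  kkt P z d = col_mx (stationarity P (x_part z) (mu_part z) (nu_part z))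
    (col_mx (\col_i (mu_part z i 0 * slack P (x_part z) i 0))
            (opf_A P *m x_part z - opf_y P d)).
Proof.
rewrite /kkt; congr (col_mx _ (col_mx _ _)).
by apply/matrixP => i j; rewrite ord1 /diagc mul_diag_mx !mxE.
Qed.

Lemma kkt_eq0P z d :
  kkt P z d = 0 <->
  [/\ stationarity P (x_part z) (mu_part z) (nu_part z) = 0,
      opf_A P *m x_part z = opf_y P d &
      forall i, mu_part z i 0 * slack P (x_part z) i 0 = 0].
Proof.
rewrite kktE; split=> [/eqP|[-> -> compl]].
  rewrite !col_mx_eq0 subr_eq0 => /and3P[/eqP-> /eqP/matrixP compl /eqP->].
  by split=> // i; have := compl i 0; rewrite mxE [RHS]mxE.
apply/eqP; rewrite !col_mx_eq0 subr_eq0 !eqxx andbT /=.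
by apply/eqP/matrixP => i j; rewrite mxE [RHS]mxE.
Qed.

Lemma kkt_block_mul z dz :
  kkt_block P z *m dz =
  col_mx (opf_Q P *m x_part dz + (opf_G R M K)^T *m mu_part dz
            + (opf_A P)^T *m nu_part dz)
  (col_mx (\col_i (mu_part z i 0 * (opf_G R M K *m x_part dz) i 0
                   + slack P (x_part z) i 0 * mu_part dz i 0))
          (opf_A P *m x_part dz)).
Proof.
rewrite -[in LHS](vsubmxK dz) -[in LHS](vsubmxK (dsubmx dz)) /kkt_block /slack.
rewrite -/(x_part dz) -/(mu_part dz) -/(nu_part dz).
move: (x_part dz) (mu_part dz) (nu_part dz) => x mu nu.
move: (opf_Q P) (opf_A P) (opf_G R M K) => Q A G.
rewrite !mul_col_mx !mul_row_col !mul0mx !addr0 addrA.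
congr (col_mx _ (col_mx _ _)); apply/matrixP => i j.
by rewrite ord1 -mulmxA /diagc !mul_diag_mx mxE ![in LHS]mxE [RHS]mxE !mxE.
Qed.

(** Minus the partial Jacobian of [kkt] in the demand, which enters only through [opf_y]. *)
Definition demand_rhs : 'M[R]_(opf_dim M K, N) :=
  col_mx 0 (col_mx 0 (col_mx (ptdf P) (const_mx 1))).

Lemma opf_yB d d' : opf_y P d' - opf_y P d =
  col_mx (ptdf P) (const_mx 1 : 'rV[R]_N) *m (d' - d).
Proof. by rewrite /opf_y -!mul_col_mx mulmxBr. Qed.

Lemma demand_rhsM d d' : demand_rhs *m (d' - d) =
  col_mx 0 (col_mx 0 (opf_y P d' - opf_y P d)).
Proof. by rewrite opf_yB /demand_rhs 2!mul_col_mx !mul0mx. Qed.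

Lemma stationarityD z dz :
  stationarity P (x_part (z + dz)) (mu_part (z + dz)) (nu_part (z + dz)) =
  stationarity P (x_part z) (mu_part z) (nu_part z)
  + (opf_Q P *m x_part dz + (opf_G R M K)^T *m mu_part dz
     + (opf_A P)^T *m nu_part dz).
Proof.
rewrite /stationarity /x_part /mu_part /nu_part !linearD /=.
(* Collects the terms at [z] first, then the increments; the constant [opf_w P] goes with the
   former. *)
by rewrite [LHS](AC (2*1*2*2) (1*3*4*6*(2*5*7))).
Qed.

Lemma mu_partD z dz i :
  mu_part (z + dz) i 0 = mu_part z i 0 + mu_part dz i 0.
Proof. by rewrite /mu_part !linearD mxE. Qed.

Lemma slackD z dz i :
  slack P (x_part (z + dz)) i 0 =
  slack P (x_part z) i 0 + (opf_G R M K *m x_part dz) i 0.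
Proof. by rewrite /slack /x_part linearD mulmxDr addrAC [LHS]mxE. Qed.

(* The factor of the i-th complementarity product that is nonzero at [z], signed
   so as to be positive at a feasible strictly complementary [z]. *)
Definition nonzero_factor z i z' : R :=
  if mu_part z i 0 == 0 then - slack P (x_part z') i 0 else mu_part z' i 0.

(** Exactly one of [m], [s] is zero. If it is [m], both equations say [dm = 0], since [s] and
    [s + ds] are nonzero; if it is [s], both say [ds = 0]. The second-order term [dm * ds] thus
    drops out. *)
Lemma complementarity_linear (m s dm ds : R) :
  m * s = 0 ->
  0 < (if m == 0 then - s else m) ->
  0 < (if m == 0 then - (s + ds) else m + dm) ->
  (m + dm) * (s + ds) = 0 <-> m * ds + s * dm = 0.
Proof.
have [->|m_neq0] := eqVneq m 0 => /eqP.
  move=> _; rewrite !oppr_gt0 mul0r !add0r => s_lt0 sds_lt0.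
  split=> /eqP; rewrite mulf_eq0 ?(lt_eqF s_lt0) ?(lt_eqF sds_lt0) ?orbF /=.
    by move=> /eqP ->; rewrite mulr0.
  by move=> /eqP ->; rewrite mul0r.
rewrite mulf_eq0 (negPf m_neq0) /= => /eqP -> _ mdm_gt0.
rewrite mul0r addr0 add0r; split=> /eqP; rewrite mulf_eq0.
  by rewrite (gt_eqF mdm_gt0) /= => /eqP ->; rewrite mulr0.
by rewrite (negPf m_neq0) /= => /eqP ->; rewrite mulr0.
Qed.

(** Stationarity and the equality constraints are affine, so their increments are exact;
    [complementarity_linear] treats the remaining block row by row. *)
Lemma kkt_eq0_linear z z' d d' :
  kkt P z d = 0 -> (forall i, 0 < nonzero_factor z i z) ->
  (forall i, 0 < nonzero_factor z i z') ->
  kkt P z' d' = 0 <-> kkt_block P z *m (z' - z) = demand_rhs *m (d' - d).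
Proof.
move=> /kkt_eq0P[grad0 Ax compl] z_gt0 z'_gt0.
set dz := z' - z; have zE : z' = z + dz by rewrite subrKC.
rewrite kkt_block_mul demand_rhsM -Ax.
have xE : x_part z' = x_part z + x_part dz by rewrite zE /x_part linearD.
have complE i := complementarity_linear (compl i) (z_gt0 i).
have gradE : stationarity P (x_part z') (mu_part z') (nu_part z') =
    opf_Q P *m x_part dz + (opf_G R M K)^T *m mu_part dz
    + (opf_A P)^T *m nu_part dz.
  by rewrite zE stationarityD grad0 add0r.
have AE : opf_A P *m x_part z' = opf_y P d' <->
    opf_A P *m x_part dz = opf_y P d' - opf_A P *m x_part z.
  rewrite xE mulmxDr; split=> [<-|->]; first by rewrite addrC addKr.
  by rewrite subrKC.
have prodE i : mu_part z' i 0 * slack P (x_part z') i 0 = 0 <->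
    mu_part z i 0 * (opf_G R M K *m x_part dz) i 0
      + slack P (x_part z) i 0 * mu_part dz i 0 = 0.
  have := z'_gt0 i; rewrite /nonzero_factor zE mu_partD slackD => ?.
  exact: complE.
split.
  move=> /kkt_eq0P[]; rewrite gradE => -> /AE -> prod0.
  congr (col_mx _ (col_mx _ _)).
  by apply/matrixP => i j; rewrite [LHS]mxE [RHS]mxE; apply/prodE.
move=> /eq_col_mx[grad' /eq_col_mx[/matrixP prod' /AE A']].
apply/kkt_eq0P; split => //; first by rewrite gradE.
by move=> i; apply/prodE; have := prod' i 0; rewrite [LHS]mxE [RHS]mxE.
Qed.

Lemma kkt_block_strict z i :
  kkt_block P z \in unitmx -> mu_part z i 0 = 0 -> slack P (x_part z) i 0 != 0.
Proof.
move=> J_unit mu0; apply/eqP => s0.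
(* Left multiplication by [u] selects the [i]-th complementarity row, which is zero if both factors
   vanish. *)
pose u : 'rV[R]_(opf_dim M K) := row_mx 0 (row_mx (delta_mx 0 i) 0).
have uJ : u *m kkt_block P z = 0.
  rewrite /u /kkt_block !mul_row_col !mul0mx addr0 add0r.
  rewrite -rowE; apply/matrixP => k j; rewrite [RHS]mxE [LHS]mxE.
  rewrite /diagc mul_diag_mx.
  case: (split_ordP j) => {}j ->; first by rewrite row_mxEl 2!mxE mu0 mul0r.
  rewrite row_mxEr; case: (split_ordP j) => {}j ->; last first.
    by rewrite row_mxEr mxE.
  by rewrite row_mxEl mxE mxE -/(slack P (x_part z)) s0 mul0rn.
have u0 : u = 0 by rewrite -(mulmxK J_unit u) uJ mul0mx.
have := congr1 (fun w => lsubmx (rsubmx w)) u0.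
rewrite row_mxKr row_mxKl !linear0 => /matrixP/(_ 0 i)/eqP.
by rewrite !mxE !eqxx oner_eq0.
Qed.

(** Writing the projection as a matrix brings it under the lemmas on affine coordinates. *)
Lemma mu_partE z : mu_part z = row_mx 0 (row_mx 1%:M 0) *m z.
Proof.
rewrite -[in RHS](vsubmxK z) -[in RHS](vsubmxK (dsubmx z)).
by rewrite !mul_row_col !mul0mx mul1mx add0r addr0.
Qed.

Lemma mul_x_partE m (C : 'M[R]_(m, opf_dim_x M K)) z :
  C *m x_part z = row_mx C 0 *m z.
Proof. by rewrite -[in RHS](vsubmxK z) mul_row_col mul0mx addr0. Qed.

Lemma slackE z i :
  slack P (x_part z) i 0 = (row_mx (opf_G R M K) 0 *m z) i 0 - opf_h P i 0.
Proof. by rewrite /slack mul_x_partE mxE [(- opf_h P) i 0]mxE. Qed.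

Lemma is_diff_kkt_coord z d i :
  is_diff z (fun z' => kkt P z' d i 0) (fun v => (kkt_block P z *m v) i 0).
Proof.
case: (split_ordP i) => {}i ->.
  set C := row_mx (opf_Q P) (row_mx (opf_G R M K)^T (opf_A P)^T).
  have -> : (fun z' => kkt P z' d (lshift _ i) 0) =
      (fun z' => (C *m z') i 0 + opf_w P i 0).
    apply/funext => z'; rewrite kktE col_mxEu.
    have -> : stationarity P (x_part z') (mu_part z') (nu_part z') =
        C *m z' + opf_w P.
      rewrite -[in RHS](vsubmxK z') -[in RHS](vsubmxK (dsubmx z')).
      by rewrite /C !mul_row_col /stationarity [LHS](AC 4 (1*(3*4)*2)).
    by rewrite mxE.
  apply: is_diff_eq (is_diff_affine_coord C _ z i) _.
  by apply/funext => v; rewrite /kkt_block mul_col_mx col_mxEu.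
case: (split_ordP i) => {}i ->; last first.
  have -> : (fun z' => kkt P z' d (rshift _ (rshift _ i)) 0) =
      (fun z' => (row_mx (opf_A P) 0 *m z') i 0 + - opf_y P d i 0).
    apply/funext => z'; rewrite kktE !col_mxEd -mul_x_partE.
    by rewrite mxE [(- opf_y P d) i 0]mxE.
  apply: is_diff_eq (is_diff_affine_coord _ _ z i) _.
  by apply/funext => v; rewrite kkt_block_mul !col_mxEd mul_x_partE.
(* A complementarity row is a product of two affine coordinates; the [+ 0] puts the first factor in
   the shape of [is_diff_affine_coord]. *)
have -> : (fun z' => kkt P z' d (rshift _ (lshift _ i)) 0) =
    (fun z' => (row_mx 0 (row_mx 1%:M 0) *m z') i 0 + 0) *
    (fun z' => (row_mx (opf_G R M K) 0 *m z') i 0 + - opf_h P i 0).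
  apply/funext => z'; rewrite kktE col_mxEd col_mxEu [LHS]mxE mu_partE slackE.
  by congr (_ * _); rewrite addr0.
have dm := is_diff_affine_coord (row_mx 0 (row_mx 1%:M 0)) 0 z i.
have ds := is_diff_affine_coord (row_mx (opf_G R M K) 0) (- opf_h P i 0) z i.
apply: is_diff_eq (is_diffM dm ds) _.
apply/funext => v; rewrite kkt_block_mul col_mxEd col_mxEu [RHS]mxE.
by rewrite addr0 mu_partE slackE mu_partE mul_x_partE.
Qed.

Lemma kkt_jacobian z d :
  differentiable (fun z' => kkt P z' d) z /\
  jacobianc (fun z' => kkt P z' d) z = kkt_block P z.
Proof. by apply: is_diff_jacobianc => i; exact: is_diff_kkt_coord. Qed.

Lemma nonzero_factor_continuous z i : continuous (nonzero_factor z i).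
Proof.
rewrite /nonzero_factor; case: eqP => _.
  have -> : (fun u => - slack P (x_part u) i 0) =
      (fun u => (- row_mx (opf_G R M K) 0 *m u) i 0 + opf_h P i 0).
    apply/funext => u; rewrite slackE opprB addrC mulNmx.
    by rewrite [(- _ : 'cV_ _) i 0]mxE.
  exact: affine_coord_continuous.
have -> : (fun u : 'cV[R]_(opf_dim M K) => mu_part u i 0) =
    (fun u => (row_mx 0 (row_mx 1%:M 0) *m u) i 0 + 0).
  by apply/funext => u; rewrite mu_partE addr0.
exact: affine_coord_continuous.
Qed.

End KKTJacobian.

(** * Differentiating the energy burden *)

Section Burden.
Variables (R : realType) (N M K : nat) (P : opf_data R N M K).

Lemma burden_jacobian (s d : 'cV[R]_N)
    (nu : 'cV[R]_N -> 'cV[R]_(opf_dim_eq M)) :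
  differentiable nu d ->
  differentiable (burden_of_demand P s nu) d /\
  lmb_matrix P s nu d =
    - (diagc (oslash d s) *m row_mx (ptdf P)^T (const_mx 1) *m jacobianc nu d)
    + diagc (oslash (price P (nu d)) s).
Proof.
move=> nu_diff; apply: is_diff_jacobianc => i.
set C := row_mx (ptdf P)^T (const_mx 1).
(* Demand over income is linear in [u], and the price is linear in [nu u]; the product rule gives
   the two terms of the formula, the chain rule the factor [jacobianc nu d]. *)
have -> : (fun u => burden_of_demand P s nu u i 0) =
    (fun u : 'cV[R]_N => (diagc (\col_i (s i 0)^-1) *m u) i 0) *
    ((fun v : 'cV[R]_(opf_dim_eq M) => (- C *m v) i 0) \o nu).
  apply/funext => u; rewrite /burden_of_demand /burden /price /diagc.
  rewrite fctE /= mulNmx -/C !mul_diag_mx [LHS]mxE; congr (_ * _).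
  by rewrite !mxE mulrC.
have dnu : is_diff d nu (mulmx (jacobianc nu d)).
  by apply: DiffDef => //; exact: diff_jacobianc.
have dpi := is_diff_mulmx_coord (- C) (nu d) i.
have dd := is_diff_mulmx_coord (diagc (\col_i (s i 0)^-1)) d i.
apply: is_diff_eq (is_diffM dd (is_diff_comp dnu dpi)) _.
apply/funext => v; set D := diagc (\col_i (s i 0)^-1).
transitivity ((D *m d) i 0 * (- C *m (jacobianc nu d *m v)) i 0 +
              (- C *m nu d) i 0 * (D *m v) i 0); first by [].
rewrite /D /price -/C mulmxDl !mulNmx -!mulmxA /diagc !mul_diag_mx.
move: (C *m (_ *m v)) (C *m nu d) => w p.
by rewrite !mxE; ring.
Qed.

End Burden.

(** * The local solution map and the signs along it *)

Section Sensitivity.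
Variables (R : realType) (N M K : nat) (P : opf_data R N M K).

(** The first-order prediction of the implicit function theorem, exact here as long as the nonzero
    factors stay positive. *)
Definition local_solution (d : 'cV[R]_N) (z : 'cV[R]_(opf_dim M K))
    (d' : 'cV[R]_N) : 'cV[R]_(opf_dim M K) :=
  z + invmx (kkt_block P z) *m (demand_rhs P *m (d' - d)).

Lemma local_solutionE d z d' :
  local_solution d z d' =
  invmx (kkt_block P z) *m demand_rhs P *m d'
  + (z - invmx (kkt_block P z) *m demand_rhs P *m d).
Proof. by rewrite /local_solution mulmxA mulmxBr addrCA. Qed.

Lemma nonzero_factor_gt0 d z :
  kkt_block P z \in unitmx -> kkt_conditions P d z ->
  forall i, 0 < nonzero_factor P z i z.
Proof.
move=> J_unit [_ [/slack_le0P Gx _] mu_ge0 _] i; rewrite /nonzero_factor.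
case: eqP => [mu0|/eqP mu_neq0].
  by rewrite oppr_gt0 lt_neqAle Gx (kkt_block_strict J_unit mu0).
by rewrite lt_neqAle eq_sym mu_neq0; have := mu_ge0 i; rewrite mxE.
Qed.

(** In each product one factor has the right strict sign, so the other is zero: both inequalities
    hold. *)
Lemma nonzero_factor_kkt_conditions d z z' :
  (forall i, 0 < nonzero_factor P z i z') -> kkt P z' d = 0 ->
  kkt_conditions P d z'.
Proof.
move=> z'_gt0 /kkt_eq0P[grad0 Ax compl].
have signs i : 0 <= mu_part z' i 0 /\ slack P (x_part z') i 0 <= 0.
  have := z'_gt0 i; rewrite /nonzero_factor; have /eqP := compl i.
  rewrite mulf_eq0; case: ifP => _ + h.
    move: h; rewrite oppr_gt0 => h; rewrite (lt_eqF h) orbF => /eqP ->.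
    by split=> //; exact: ltW.
  by rewrite (gt_eqF h) /= => /eqP ->; split=> //; exact: ltW.
split=> //; last by move=> i; rewrite mxE; case: (signs i).
by split=> //; apply/slack_le0P => i; case: (signs i).
Qed.

End Sensitivity.

Theorem propositionB1 (R : realType) (N M K : nat) (P : opf_data R N M K)
    (s d : 'cV[R]_N) (z : 'cV[R]_(opf_dim M K))
    (gen_inj : injective (gen_node P))
    (tau_gt0 : 0 < tau P)
    (s_gt0 : forall i, 0 < s i 0)
    (z_sol : primal_dual_solution P d z)
    (J_unit : jacobianc (fun z' => kkt P z' d) z \in unitmx) :
  (differentiable (fun z' => kkt P z' d) z /\
   jacobianc (fun z' => kkt P z' d) z = kkt_block P z) /\
  exists (U : set 'cV[R]_N) (V : set 'cV[R]_(opf_dim M K))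
         (zeta : 'cV[R]_N -> 'cV[R]_(opf_dim M K)),
    [/\ open_nbhs d U, open_nbhs z V, zeta d = z,
        (forall d', U d' ->
          [/\ V (zeta d'),
              primal_dual_solution P d' (zeta d') &
              forall z', V z' -> (kkt P z' d' = 0 <-> z' = zeta d')]) &
        let nu := fun d' => nu_part (zeta d') in
        forall d', U d' ->
          [/\ differentiable nu d',
              differentiable (burden_of_demand P s nu) d' &
              lmb_matrix P s nu d' =
                - (diagc (oslash d' s) *m row_mx (ptdf P)^T (const_mx 1)
                     *m jacobianc nu d')
                + diagc (oslash (price P (nu d')) s)]].
Proof.
have [kkt_diff jacE] := kkt_jacobian P z d.
rewrite jacE in J_unit; split=> //.
have [Q_ge0 z_kkt] := primal_dual_solution_kkt z_sol.
have z_gt0 := nonzero_factor_gt0 J_unit z_kkt.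
have kkt0 : kkt P z d = 0.
  by apply/kkt_eq0P; case: z_kkt => grad0 [_ Ax] _ compl.
pose zeta := local_solution P d z.
have zeta_diff d' : differentiable zeta d'.
  have -> : zeta = _ := funext (local_solutionE P d z).
  by have [] := affine_jacobianc (invmx (kkt_block P z) *m demand_rhs P)
    (z - invmx (kkt_block P z) *m demand_rhs P *m d) d'.
(* Where the factors are positive, KKT points solve a linear system with invertible matrix, hence
   uniqueness. *)
have zetaE z' d' : (forall i, 0 < nonzero_factor P z i z') ->
    kkt P z' d' = 0 <-> z' = zeta d'.
  move=> z'_gt0; rewrite (kkt_eq0_linear _ kkt0 z_gt0 z'_gt0).
  rewrite /zeta /local_solution; split=> [<-|->].
    by rewrite mulKmx // subrKC.
  by rewrite [z + _]addrC addrK mulKVmx.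
(* [U] is the preimage of [V] under [zeta]: it is open by continuity, and [zeta] maps it into
   [V]. *)
exists [set d' | forall i, 0 < nonzero_factor P z i (zeta d')].
exists [set z' | forall i, 0 < nonzero_factor P z i z'], zeta.
have zeta_d : zeta d = z by rewrite /zeta /local_solution subrr !mulmx0 addr0.
split=> //.
- split=> /=; last by rewrite zeta_d.
  apply: open_forall_gt0 => i u.
  apply: continuous_comp; first exact: differentiable_continuous.
  exact: nonzero_factor_continuous.
- by split=> //; apply: open_forall_gt0; exact: nonzero_factor_continuous.
- move=> d' d'_gt0; split=> // [|z']; last exact: zetaE.
  apply: kkt_primal_dual_solution => //.
  by apply: (nonzero_factor_kkt_conditions d'_gt0); exact/(zetaE _ _ d'_gt0).
move=> nu d' _; have nu_diff : differentiable nu d'.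
  set Z := invmx (kkt_block P z) *m demand_rhs P.
  (* The prices' dual variables are the bottom rows of the affine map [zeta]. *)
  have -> : nu = fun d' => dsubmx (dsubmx Z) *m d' + nu_part (z - Z *m d).
    apply/funext => u; rewrite /nu /zeta local_solutionE -/Z /nu_part.
    by rewrite !linearD /= -!mul_dsub_mx.
  by have [] := affine_jacobianc (dsubmx (dsubmx Z)) (nu_part (z - Z *m d)) d'.
by have [] := burden_jacobian P s nu_diff.
Qed.
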